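(* Let $\beta_1>\beta_2>\cdots>\beta_K>0$, let $f^e:(-\infty,0]\to\mathbb{R}$ be continuous and strictly decreasing with $f^e(0)=0$, and let $c_k(s)=\beta_kf^e(s)$ for $s\le 0$ and $c_k(s)=+\infty$ for $s>0$ (late arrival prohibited), $k\in\mathcal K=\{1,\dots,K\}$. Let $\mu>0$, $Q_k>0$, $Q=\sum_{k\in\mathcal K}Q_k$, $T=Q/\mu$, and consider the linear program $$\text{[2D-LP]}\quad\min_{\mathbf{x}\ge0}\ \sum_{k\in\mathcal K}\int_{\mathcal S}c_k(s)x_k(s)\,\mathrm{d}s\quad\text{s.t.}\quad\sum_{k\in\mathcal K}x_k(s)\le\mu\ \ \forall s\in\mathcal S,\qquad\int_{\mathcal S}x_k(s)\,\mathrm{d}s=Q_k\ \ \forall k\in\mathcal K.$$ Put $s_0=0$ and $s_k=\sum_{k'\le k}Q_{k'}/\mu$ for $k\in\mathcal K$. Then: (1) The optimal solution $\mathbf{x}^*$ of [2D-LP] (the equilibrium flow pattern) is unique, and in terms of reversed time $z=-s\in\mathcal Z=[0,T]$ its cumulative form $F^*(\kappa,z)=\sum_{k'\le\kappa}\int_0^z x^*_{k'}(-z')\,\mathrm{d}z'$ is $$F^*(\kappa,z)=\min\Big\{\sum_{k'\le\kappa}Q_{k'},\ \mu z\Big\}\qquad\forall\kappa\in[1,K],\ \forall z\in\mathcal Z .$$ (2) $\mathbf{x}^*$ has the sorting property: for every $k\in\mathcal K$ all users in group $k$ depart from the bottleneck in the time interval $[-s_k,-s_{k-1}]$ of length $Q_k/\mu$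 (i.e. $x_k^*(s)=0$ for almost every $s\in\mathcal S\setminus[-s_k,-s_{k-1}]$), and $$-T=-s_K<-s_{K-1}<\cdots<-s_2<-s_1<-s_0=0 .$$
   Context: $\mathcal S\subset\mathbb R$ is a given, sufficiently long time interval (containing $[-T,T]$ in its interior). The unknowns $x_k$ are nonnegative measurable functions on $\mathcal S$ (departure flow rates of group $k$ from a single bottleneck of capacity $\mu$); constraints on $s$ are understood for almost every $s$, and flows equal almost everywhere are identified. The cost $+\infty$ for $s>0$ means $x_k(s)=0$ for almost every $s>0$. All users have the same preferred departure time $0$. The index $k'$ ranges over integers in $\{1,\dots,K\}$, while $\kappa$ is a real number. *)

(* Defs.v *)
From HB Require Import structures.
From mathcomp Require Import all_boot all_order all_algebra.
From mathcomp Require Import all_classical all_reals all_analysis.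

Set Implicit Arguments.
Unset Strict Implicit.
Unset Printing Implicit Defensive.

Import Order.TTheory GRing.Theory Num.Theory.
Import numFieldNormedType.Exports.

Local Open Scope classical_set_scope.
Local Open Scope ring_scope.

(* Group k of {1, ..., K} is represented by the ordinal i : 'I_K with
   i.+1 = k. In particular, k <= j (j : nat) reads (i < j)%N and k <= kappa
   (kappa real) reads i.+1%:R <= kappa. *)

Section BottleneckLP.
Context {R : realType} {K : nat}.
Implicit Types (S : set R) (c : 'I_K -> R -> \bar R) (mu : R) (Q : 'I_K -> R).
Implicit Types (x y : 'I_K -> R -> R).

(* With the convention +oo * 0 = 0, the value +oo for s > 0 makes the objective
   of a feasible x infinite unless x i vanishes almost everywhere on s > 0. *)
Definition late_prohibited_cost (beta : 'I_K -> R) (fe : R -> R)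
    (i : 'I_K) (s : R) : \bar R :=
  if s <= 0 then (beta i * fe s)%:E else +oo%E.

(* Nonnegativity is imposed almost everywhere, like the capacity constraint,
   so that feasibility is invariant under a.e. equality of flows. *)
Definition lp_feasible S mu Q x : Prop :=
  [/\ forall i, measurable_fun S (x i),
      forall i, {ae lebesgue_measure, forall s, S s -> 0 <= x i s},
      {ae lebesgue_measure, forall s, S s -> \sum_(i < K) x i s <= mu} &
      forall i, (\int[lebesgue_measure]_(s in S) (x i s)%:E = (Q i)%:E)%E].

Definition lp_objective S c x : \bar R :=
  (\sum_(i < K) \int[lebesgue_measure]_(s in S) (c i s * (x i s)%:E))%E.

Definition lp_optimal S c mu Q x : Prop :=
  lp_feasible S mu Q x /\
  forall y, lp_feasible S mu Q y ->
    (lp_objective S c x <= lp_objective S c y)%E.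

Definition flow_ae_eq S x y : Prop :=
  forall i, {ae lebesgue_measure, forall s, S s -> x i s = y i s}.

(* s_k = (Q_1 + ... + Q_k) / mu, with s_0 = 0 as an empty sum. *)
Definition breakpoint mu Q (k : nat) : R :=
  (\sum_(i < K | (i < k)%N) Q i) / mu.

(* F(kappa, z), in reversed time z = - s. *)
Definition cumulative_flow x (kappa z : R) : \bar R :=
  (\sum_(i < K | (i.+1%:R <= kappa)%R)
    \int[lebesgue_measure]_(z' in `[0%R, z]) (x i (- z')%R)%:E)%E.

End BottleneckLP.

(* Main.v *)
Require Import Defs.
From HB Require Import structures.
From mathcomp Require Import all_boot all_order all_algebra.
From mathcomp Require Import all_classical all_reals all_analysis.
From mathcomp Require Import measurable_realfun ring lra.

Set Implicit Arguments.
Unset Strict Implicit.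
Unset Printing Implicit Defensive.

Import Order.TTheory GRing.Theory Num.Theory.
Import numFieldNormedType.Exports.

Local Open Scope classical_set_scope.
Local Open Scope ring_scope.

(* Write beta_i as the sum over j >= i of the positive gaps
   beta_j - beta_(j+1), with beta_(K+1) = 0. The objective becomes a positive
   combination, over j, of the costs of the aggregate flows
   Y_j = x_1 + ... + x_j at the common unit cost fe (+oo for late arrivals).
   Each Y_j lies between 0 and mu and has mass Q_1 + ... + Q_j, so by the bathtub
   principle its cost is minimal exactly when Y_j = mu on ]-s_j, 0] and 0
   elsewhere. The sorted flow attains all these minima at once; hence it is
   optimal, and any optimal flow has the same aggregates almost everywhere. *)

(** * The bathtub principle on a measure space *)

Section Bathtub.
Context d (T : measurableType d) (R : realType) (nu : {measure set T -> \bar R}).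
Local Open Scope ereal_scope.

(** The common finite integral makes both functions integrable, so [g - f] is almost everywhere
    nonnegative with integral zero, and hence vanishes almost everywhere. *)
Lemma ge0_le_integral_ae_eq (D : set T) (f g : T -> \bar R) :
  measurable D -> measurable_fun D f -> measurable_fun D g ->
  (forall t, D t -> 0 <= f t) -> (forall t, D t -> 0 <= g t) ->
  {ae nu, forall t, D t -> f t <= g t} ->
  \int[nu]_(t in D) f t < +oo -> \int[nu]_(t in D) g t = \int[nu]_(t in D) f t ->
  {ae nu, forall t, D t -> f t = g t}.
Proof.
move=> mD mf mg f0 g0 fg foo gf.
have intf : nu.-integrable D f.
  apply/integrableP; split=> //.
  by under eq_integral => t /[!inE] Dt do rewrite gee0_abs ?f0//.
have intg : nu.-integrable D g.
  apply/integrableP; split=> //.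
  by under eq_integral => t /[!inE] Dt do rewrite gee0_abs ?g0//; rewrite gf.
have ffin := integrable_ae mD intf.
have mgf : measurable_fun D (g \- f) by exact: emeasurable_funB.
have : \int[nu]_(t in D) `|(g \- f) t| = 0.
  rewrite (ae_eq_integral (g \- f)) //; last 2 first.
  - exact: measurableT_comp.
  - apply: filterS2 fg ffin => t fg ffin Dt /=.
    by rewrite gee0_abs// sube_ge0 ?fg//; apply/orP; left; exact: ffin.
  by rewrite integralB// gf subee// ?ge0_fin_numE//; exact: integral_ge0.
move=> /(ae_eq_integral_abs nu mD mgf) gf0.
apply: filterS2 gf0 ffin => t gf0 ffin Dt.
(* A zero difference yields equality of the two values because [f t] is finite. *)
have := gf0 Dt; have := ffin Dt; rewrite /=.
by case: (f t) (g t) => [r| |] [q| |]//= _ [] /eqP; rewrite subr_eq0 => /eqP ->.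
Qed.

Variables (D A : set T) (G : T -> \bar R) (b m : R) (Y : T -> R).
Hypotheses (mD : measurable D) (mA : measurable A) (AD : A `<=` D).
Hypotheses (mG : measurable_fun D G) (G0 : forall t, D t -> 0 <= G t).
Hypotheses (b0 : (0 <= b)%R) (m0 : (0 <= m)%R).
Hypotheses (GA : forall t, A t -> G t <= b%:E).
Hypotheses (GC : forall t, D t -> ~ A t -> b%:E <= G t).
Hypotheses (mY : measurable_fun D Y) (Y0 : forall t, D t -> (0 <= Y t)%R).
Hypothesis Ym : {ae nu, forall t, D t -> (Y t <= m)%R}.
Hypotheses (Afin : nu A < +oo).
Hypothesis YA : \int[nu]_(t in D) (Y t)%:E = m%:E * nu A.

(** The extremal profile: full level [m] on [A], nothing elsewhere. By [GA] and [GC], [A] is a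
    sublevel set of [G] in [D] up to ties at [b]; by [YA], the profile has the same mass as [Y]. *)
Let a t : R := (m * \1_A t)%R.

Let a0 t : (0 <= a t)%R.
Proof. by rewrite mulr_ge0// indicE. Qed.

Let ma : measurable_fun D a.
Proof. by apply: measurable_funM => //; exact: measurable_indic. Qed.

Let mEa : measurable_fun D (EFin \o a).
Proof. exact/measurable_EFinP. Qed.

Let mEY : measurable_fun D (EFin \o Y).
Proof. exact/measurable_EFinP. Qed.

Let int_a : \int[nu]_(t in D) (a t)%:E = m%:E * nu A.
Proof.
under eq_integral do rewrite EFinM.
rewrite ge0_integralZl//=; last 1 first.
- by apply/measurable_EFinP; exact: measurable_indic.
- by rewrite integral_indic// setIidl.
Qed.

(* This is (b - G t) * (a t - Y t) >= 0, rearranged without subtraction since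
   G may take the value +oo. *)
Let pointwise t : D t -> (Y t <= m)%R ->
  G t * (a t)%:E + b%:E * (Y t)%:E <= G t * (Y t)%:E + b%:E * (a t)%:E.
Proof.
move=> Dt Ytm; have Yt0 := Y0 Dt; rewrite /a indicE.
have [At|At] := pselect (A t); rewrite ?(mem_set At) ?(memNset At).
  rewrite mulr1.
  have := GA At; have := G0 Dt; case: (G t) => [r| |]//=.
  by rewrite !lee_fin => r0 rb; nra.
rewrite mulr0 !mule0 add0e adde0.
by apply: lee_pmul => //; [exact: GC].
Qed.

(** Where [G t] is finite, equality says [(b - G t) * (a t - Y t) = 0] with a nonzero first factor.
    Where it is [+oo], a positive [Y t] would make only the right-hand side infinite. *)
Let pointwise_eq t : D t -> G t != b%:E ->
  G t * (a t)%:E + b%:E * (Y t)%:E = G t * (Y t)%:E + b%:E * (a t)%:E ->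
  Y t = a t.
Proof.
move=> Dt Gb; have Yt0 := Y0 Dt; rewrite /a indicE.
have [At|At] := pselect (A t); rewrite ?(mem_set At) ?(memNset At).
  rewrite mulr1.
  have := GA At; have := G0 Dt; move: Gb; case: (G t) => [r| |]//=.
  rewrite eqe !lee_fin => rb r0 rlb [] H.
  have /eqP : ((r - b) * (m - Y t) = 0)%R by lra.
  by rewrite mulf_eq0 !subr_eq0 (negbTE rb)/= => /eqP.
rewrite mulr0 !mule0 add0e adde0.
have := GC Dt At; move: Gb; case: (G t) => [r| |]//=.
  rewrite eqe !lee_fin => rb br [] H.
  have /eqP : ((r - b) * Y t = 0)%R by lra.
  by rewrite mulf_eq0 subr_eq0 (negbTE rb)/= => /eqP.
move=> _ _; move: Yt0; rewrite le_eqVlt => /orP[/eqP <-//|Y0'].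
by rewrite gt0_mulye ?lte_fin.
Qed.

Let m1 : measurable_fun D (fun t => G t * (a t)%:E).
Proof. exact: emeasurable_funM. Qed.
Let m2 : measurable_fun D (fun t => b%:E * (Y t)%:E).
Proof. exact: emeasurable_funM. Qed.
Let m3 : measurable_fun D (fun t => G t * (Y t)%:E).
Proof. exact: emeasurable_funM. Qed.
Let m4 : measurable_fun D (fun t => b%:E * (a t)%:E).
Proof. exact: emeasurable_funM. Qed.
Let p1 t : D t -> 0 <= G t * (a t)%:E.
Proof. by move=> Dt; rewrite mule_ge0 ?G0// lee_fin. Qed.
Let p2 t : D t -> 0 <= b%:E * (Y t)%:E.
Proof. by move=> Dt; rewrite mule_ge0 ?lee_fin ?Y0. Qed.
Let p3 t : D t -> 0 <= G t * (Y t)%:E.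
Proof. by move=> Dt; rewrite mule_ge0 ?G0// lee_fin Y0. Qed.
Let p4 t : D t -> 0 <= b%:E * (a t)%:E.
Proof. by move=> Dt; rewrite mule_ge0 ?lee_fin. Qed.

Let int_l : \int[nu]_(t in D) (G t * (a t)%:E + b%:E * (Y t)%:E) =
  \int[nu]_(t in D) (G t * (a t)%:E) + b%:E * (m%:E * nu A).
Proof.
by rewrite ge0_integralD// ge0_integralZl// YA.
Qed.

Let int_r : \int[nu]_(t in D) (G t * (Y t)%:E + b%:E * (a t)%:E) =
  \int[nu]_(t in D) (G t * (Y t)%:E) + b%:E * (m%:E * nu A).
Proof.
rewrite ge0_integralD// ge0_integralZl//; first by rewrite int_a.
by move=> t _; rewrite lee_fin.
Qed.

Let bmfin : b%:E * (m%:E * nu A) \is a fin_num.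
Proof. by rewrite !fin_numM// ge0_fin_numE. Qed.

(** Integrating [pointwise] adds the same finite amount [b * m * nu A] on both sides, since [a] and
    [Y] have equal mass; it cancels. *)
Lemma bathtub_le :
  \int[nu]_(t in D) (G t * (m * \1_A t)%:E) <= \int[nu]_(t in D) (G t * (Y t)%:E).
Proof.
rewrite -(leeD2rE _ _ bmfin) -int_l -int_r; apply: ae_ge0_le_integral => //.
- by move=> t Dt; rewrite adde_ge0 ?p1 ?p2.
- exact: emeasurable_funD.
- by move=> t Dt; rewrite adde_ge0 ?p3 ?p4.
- exact: emeasurable_funD.
- by apply: filterS Ym => t Ytm Dt; apply: pointwise => //; exact: Ytm.
Qed.

Lemma bathtub_fin : \int[nu]_(t in D) (G t * (m * \1_A t)%:E) < +oo.
Proof.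
apply: (@le_lt_trans _ _ (\int[nu]_(t in D) (b%:E * (a t)%:E))).
  apply: ge0_le_integral => // t Dt; rewrite /a indicE.
  have [At|At] := pselect (A t); rewrite ?(mem_set At) ?(memNset At).
    by rewrite lee_wpmul2r ?GA// lee_fin mulr1.
  by rewrite mulr0 !mule0.
rewrite ge0_integralZl//; first by rewrite int_a ltey_eq bmfin.
by move=> t _; rewrite lee_fin.
Qed.

(** Equal costs turn the integrated inequality into an equality, so [pointwise] is an equality
    almost everywhere. Nothing is forced where [G t = b]: mass moves inside that set at no cost. *)
Lemma bathtub_eq :
  \int[nu]_(t in D) (G t * (Y t)%:E) = \int[nu]_(t in D) (G t * (m * \1_A t)%:E) ->
  {ae nu, forall t, D t -> G t != b%:E -> Y t = (m * \1_A t)%R}.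
Proof.
move=> eqI.
suff : {ae nu, forall t, D t ->
    G t * (a t)%:E + b%:E * (Y t)%:E = G t * (Y t)%:E + b%:E * (a t)%:E}.
  by apply: filterS => t E Dt Gb; apply: pointwise_eq => //; exact: E.
apply: ge0_le_integral_ae_eq => //.
- exact: emeasurable_funD.
- exact: emeasurable_funD.
- by move=> t Dt; rewrite adde_ge0 ?p1 ?p2.
- by move=> t Dt; rewrite adde_ge0 ?p3 ?p4.
- by apply: filterS Ym => t Ytm Dt; apply: pointwise => //; exact: Ytm.
- by rewrite int_l lte_add_pinfty ?bathtub_fin// ltey_eq bmfin.
- by rewrite int_l int_r eqI.
Qed.

End Bathtub.

(* Instance search fails to recognise the bare function [lebesgue_measure] as a
   measure. *)
#[local] Instance lebesgue_ae_filter (R : realType) :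
  Filter (nbhs (almost_everywhere (@lebesgue_measure R))).
Proof. exact: ae_filter_ringOfSetsType. Qed.

(** * Time reversal and null sets *)

Section Reflection.
Context {R : realType}.
Notation leb := (@lebesgue_measure R).

Lemma ae_oppr (P : R -> Prop) : {ae leb, forall s, P s} -> {ae leb, forall s, P (- s)}.
Proof.
move=> [N [mN N0 PN]]; exists (-%R @^-1` N); split.
- have mopp : measurable_fun [set: R] (-%R : R -> R) by exact: oppr_measurable.
  by rewrite -[X in measurable X]setTI; exact: mopp.
- by have := lebesgue_measureN mN; rewrite N0.
- by move=> s /= Ps; apply: PN.
Qed.

End Reflection.

(** * Finite sums: telescoping, recovery of terms, and equality in weighted sums *)

Lemma sumr_ord_telescope (V : zmodType) (f : nat -> V) (n m : nat) : (n <= m)%N ->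
  \sum_(i < m | (i < n)%N) (f i.+1 - f i) = f n - f 0%N.
Proof.
move=> nm; rewrite -(big_ord_widen _ (fun i => f i.+1 - f i) nm).
by rewrite -(big_mkord xpredT (fun i => f i.+1 - f i)) telescope_sumr.
Qed.

(** By strong induction, the terms below [i] agree and cancel from the [i]-th partial sums. This
    recovers single flows from their aggregates. *)
Lemma partial_sums_inj (V : zmodType) (n : nat) (f g : 'I_n -> V) :
  (forall j : 'I_n, \sum_(i < n | (i <= j)%N) f i = \sum_(i < n | (i <= j)%N) g i) ->
  f =1 g.
Proof.
move=> fg i; have [m] := ubnP (i : nat); elim: m i => // m IH i /ltnSE im.
have := fg i; rewrite (bigD1 i)//= [RHS](bigD1 i)//=.
rewrite (eq_bigr g) => [/addIr//|k /andP[ki neq]].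
by apply: IH; apply: leq_trans im; rewrite ltn_neqAle; apply/andP; split.
Qed.

(** One strict inequality [v i < u i] would make the weighted totals strictly ordered; finiteness of
    [v] keeps strictness when the other terms are added. *)
Lemma sume_le_eq (R : realDomainType) (I : finType) (g : I -> R) (u v : I -> \bar R) :
  (forall i, 0 < g i) -> (forall i, v i \is a fin_num) ->
  (forall i, (v i <= u i)%E) ->
  (\sum_i (g i)%:E * u i <= \sum_i (g i)%:E * v i)%E -> u =1 v.
Proof.
move=> g0 vfin vu uv i; apply/eqP; rewrite eq_le vu andbT leNgt.
apply/negP => vui; move: uv; apply/negP; rewrite -ltNge.
rewrite (bigD1 i)//= [ltRHS](bigD1 i)//=; apply: lte_leD.
- by apply/sum_fin_numP => j _ _; rewrite fin_numM.
- by rewrite lte_pmul2l// lte_fin.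
- by apply: lee_sum => j _; rewrite lee_pmul2l// lte_fin.
Qed.

(** * Breakpoints, the sorted flow and its cumulative form *)

Section Breakpoints.
Context {R : realType} {K : nat} (mu : R) (Q : 'I_K -> R).
Hypotheses (mu_gt0 : 0 < mu) (Q_gt0 : forall i, 0 < Q i).
Local Notation s_ := (breakpoint mu Q).

Lemma breakpoint0 : s_ 0 = 0.
Proof. by rewrite /breakpoint big_pred0// mul0r. Qed.

Lemma breakpointS (i : 'I_K) : s_ i.+1 = s_ i + Q i / mu.
Proof.
rewrite /breakpoint -mulrDl (bigD1 i)//= addrC; congr ((_ + _) / _).
by apply: eq_bigl => k; rewrite ltnS ltn_neqAle andbC.
Qed.

Lemma breakpoint_last : s_ K = (\sum_i Q i) / mu.
Proof. by rewrite /breakpoint; congr (_ / _); apply: eq_bigl => i; rewrite ltn_ord. Qed.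

Lemma le_breakpoint (m n : nat) : (m <= n)%N -> s_ m <= s_ n.
Proof.
move=> mn; rewrite /breakpoint ler_pM2r ?invr_gt0//.
rewrite big_mkcond [leRHS]big_mkcond; apply: ler_sum => i _.
case: (ltnP i m) => im; first by rewrite (leq_trans im mn).
by case: ifP => // _; exact: ltW.
Qed.

Lemma breakpoint_ge0 (n : nat) : 0 <= s_ n.
Proof. by rewrite -breakpoint0 le_breakpoint. Qed.

Lemma lt_breakpoint (i : 'I_K) : s_ i < s_ i.+1.
Proof. by rewrite breakpointS ltrDl divr_gt0. Qed.

(** Half-open intervals tile []- s_ K, 0]] without overlap, so the aggregates are exact at every
    point and not merely almost everywhere. *)
Definition sorted_flow (i : 'I_K) (s : R) : R := mu * \1_(`]- s_ i.+1, - s_ i]) s.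

Lemma sorted_flow_ge0 i s : 0 <= sorted_flow i s.
Proof. by rewrite mulr_ge0 ?(ltW mu_gt0)// indicE. Qed.

(** A difference of nested windows ending at [0], the form in which sums over groups telescope. *)
Lemma sorted_flowE i s :
  sorted_flow i s = mu * \1_(`]- s_ i.+1, 0]) s - mu * \1_(`]- s_ i, 0]) s.
Proof.
have si := lt_breakpoint i; have s0 := breakpoint_ge0 i.
rewrite /sorted_flow -mulrBr !indicE !mem_setE !in_itv/=; congr (_ * _).
(* The cases left after simplification contradict [- s_ i.+1 < - s_ i <= 0]. *)
have [h1|h1] := leP s 0; have [h2|h2] := ltP (- s_ i.+1) s;
  have [h3|h3] := ltP (- s_ i) s => //=; rewrite ?subr0 ?subrr//=.
all: exfalso; lra.
Qed.

Lemma sum_sorted_flow (n : nat) s : (n <= K)%N ->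
  \sum_(i < K | (i < n)%N) sorted_flow i s = mu * \1_(`]- s_ n, 0]) s.
Proof.
move=> nK; under eq_bigr do rewrite sorted_flowE.
rewrite (sumr_ord_telescope (fun k => mu * \1_(`]- s_ k, 0]) s))//.
by rewrite breakpoint0 oppr0 set_itvoc0 indic0 mulr0 subr0.
Qed.

Lemma measurable_sorted_flow D i : measurable_fun D (sorted_flow i).
Proof. by apply: measurable_funM => //; exact: measurable_indic. Qed.

Lemma integral_sorted_flow (S : set R) (i : 'I_K) : measurable S ->
  `]- s_ i.+1, - s_ i] `<=` S ->
  (\int[lebesgue_measure]_(s in S) (sorted_flow i s)%:E = (Q i)%:E)%E.
Proof.
move=> mS IS; under eq_integral do rewrite EFinM.
rewrite ge0_integralZl//=; last 2 first.
- by apply/measurable_EFinP; exact: measurable_indic.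
- by rewrite lee_fin ltW.
rewrite integral_indic// setIidl//= lebesgue_measure_itv/= lte_fin ltrN2 lt_breakpoint.
rewrite -EFinB -EFinM; congr EFin.
by rewrite breakpointS; field; rewrite gt_eqF.
Qed.

(** Writing the clipped length as a difference of minima covers all positions of [z] and telescopes
    over consecutive breakpoints. *)
Lemma lebesgue_measure_clip (a b z : R) : 0 <= a -> a <= b -> 0 <= z ->
  lebesgue_measure (`[a, b[ `&` `[0, z]) = (Num.min b z - Num.min a z)%:E.
Proof.
move=> a0 ab z0; have [za|az] := ltP z a.
  rewrite !min_r ?subrr ?(ltW za)//; last exact: le_trans (ltW za) ab.
  rewrite (_ : _ `&` _ = set0) ?measure0//.
  by apply/seteqP; split=> t //=; rewrite !in_itv/= => -[/andP[? ?] /andP[? ?]]; lra.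
have [bz|zb] := leP b z.
  rewrite setIidl; last by move=> t /=; rewrite !in_itv/= => /andP[? ?]; lra.
  rewrite lebesgue_measure_itv/= lte_fin; case: ltP => // ba.
  by congr EFin; apply/esym/eqP; rewrite subr_eq0 eq_le ab ba.
rewrite (_ : _ `&` _ = `[a, z]%classic); last first.
  apply/seteqP; split=> t /=; rewrite !in_itv/= => H.
    by case: H => /andP[? ?] /andP[? ?]; lra.
  by move: H => /andP[? ?]; split; lra.
rewrite lebesgue_measure_itv/= lte_fin; case: ltP => // za.
by congr EFin; apply/esym/eqP; rewrite subr_eq0 eq_le az za.
Qed.

Lemma cumulative_flow_sorted (kappa z : R) : kappa <= K%:R -> 0 <= z ->
  cumulative_flow sorted_flow kappa z =
  (Num.min (\sum_(i < K | i.+1%:R <= kappa) Q i) (mu * z))%:E.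
Proof.
move=> kK z0; rewrite /cumulative_flow.
have int_i (i : 'I_K) :
    (\int[lebesgue_measure]_(t in `[0%R, z]) (sorted_flow i (- t)%R)%:E =
     (mu * Num.min (s_ i.+1) z - mu * Num.min (s_ i) z)%:E)%E.
  (* Reflection exchanges the open and closed ends of the interval. *)
  transitivity (\int[lebesgue_measure]_(t in `[0%R, z])
      (mu%:E * (\1_(`[s_ i, s_ i.+1[) t)%:E))%E.
    apply: eq_integral => t _; rewrite /sorted_flow EFinM; congr (_ * (_)%:E)%E.
    by rewrite !indicE !mem_setE !in_itv/= ltrN2 lerN2 andbC.
  rewrite ge0_integralZl//=; last 2 first.
  - by apply/measurable_EFinP; exact: measurable_indic.
  - by rewrite lee_fin ltW.
  rewrite integral_indic//= lebesgue_measure_clip ?breakpoint_ge0 ?le_breakpoint//.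
  by rewrite -EFinM mulrBr.
rewrite (eq_bigr _ (fun i _ => int_i i)) sumEFin; congr EFin.
(* The real [kappa] matters only through its integer part: the groups counted are those with
   [i < Num.truncn kappa]. *)
have nK : (Num.truncn kappa <= K)%N.
  by rewrite -[leqRHS](@natrK R) le_truncn.
rewrite (eq_bigl _ _ (fun i : 'I_K => esym (truncn_gt_nat kappa i))).
rewrite (sumr_ord_telescope (fun k => mu * Num.min (s_ k) z))//.
rewrite breakpoint0 (min_l z0) mulr0 subr0 minr_pMr ?ltW//.
rewrite /breakpoint mulrC divfK ?gt_eqF//; congr Num.min.
by apply: eq_bigl => i; rewrite truncn_gt_nat.
Qed.

End Breakpoints.

(** * Null sets and invariance under almost everywhere equality of flows *)

Lemma ae_neq {R : realType} (c : R) : {ae lebesgue_measure, forall s, s != c}.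
Proof.
exists [set c]; split=> //; first exact: lebesgue_measure_set1.
by move=> s /= /negP; rewrite negbK => /eqP.
Qed.

Section AlmostEverywhere.
Context {R : realType} {K : nat} (S : set R) (mS : measurable S).
Implicit Types x y : 'I_K -> R -> R.

Lemma flow_ae_eq_sym x y : flow_ae_eq S x y -> flow_ae_eq S y x.
Proof. by move=> xy i; apply: filterS (xy i) => s + Ss => ->. Qed.

Lemma flow_ae_eq_trans x y z :
  flow_ae_eq S x y -> flow_ae_eq S y z -> flow_ae_eq S x z.
Proof. by move=> xy yz i; apply: filterS2 (xy i) (yz i) => s + + Ss => -> // ->. Qed.

Lemma lp_feasible_ae mu Q x y : (forall i, measurable_fun S (y i)) ->
  flow_ae_eq S x y -> lp_feasible S mu Q x -> lp_feasible S mu Q y.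
Proof.
move=> my xy [mx x0 xmu xQ]; split=> //.
- by move=> i; apply: filterS2 (xy i) (x0 i) => s xys xs Ss; rewrite -xys// xs.
- have xyA : {ae lebesgue_measure, forall s, forall i, S s -> x i s = y i s}.
    exact: filter_forall.
  apply: filterS2 xyA xmu => s xys xs Ss.
  by under eq_bigr do rewrite -xys//; exact: xs.
- move=> i; rewrite -xQ; apply: ae_eq_integral => //.
  + by apply/measurable_EFinP; exact: my.
  + by apply/measurable_EFinP; exact: mx.
  + by apply: filterS (xy i) => s xys Ss /=; rewrite xys.
Qed.

Lemma lp_objective_ae (c : 'I_K -> R -> \bar R) x y :
  (forall i, measurable_fun S (c i)) ->
  (forall i, measurable_fun S (x i)) -> (forall i, measurable_fun S (y i)) ->
  flow_ae_eq S x y -> lp_objective S c x = lp_objective S c y.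
Proof.
move=> mc mx my xy; apply: eq_bigr => i _.
have mcz z : measurable_fun S z -> measurable_fun S (fun s => c i s * (z s)%:E)%E.
  move=> mz; apply: emeasurable_funM; first exact: mc.
  by apply/measurable_EFinP; exact: mz.
apply: ae_eq_integral => //; [exact: mcz|exact: mcz|].
by apply: filterS (xy i) => s xys Ss /=; rewrite xys.
Qed.

Lemma cumulative_flow_ae x y (kappa z : R) : `[- z, 0] `<=` S ->
  (forall i, measurable_fun S (x i)) -> (forall i, measurable_fun S (y i)) ->
  flow_ae_eq S x y -> cumulative_flow x kappa z = cumulative_flow y kappa z.
Proof.
move=> zS mx my xy; apply: eq_bigr => i _.
have oppS t : `[0, z]%classic t -> S (- t).
  rewrite /= in_itv/= => /andP[t0 tz]; apply: zS.
  by rewrite /= in_itv/= lerN2 tz oppr_le0.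
have mopp (f : R -> R) : measurable_fun S f ->
    measurable_fun `[0, z] (fun t => (f (- t))%:E).
  move=> mf; apply/measurable_EFinP; apply: (measurable_comp mS) => //.
  by move=> _ [t /oppS ? <-].
apply: ae_eq_integral => //; [exact: mopp|exact: mopp|].
by apply: filterS (ae_oppr (xy i)) => t /= xyt /oppS/xyt ->.
Qed.

(** Feasible flows are nonnegative only almost everywhere; this representative is nonnegative at
    every point, as the aggregate arguments require. *)
Let pos x i := x i \max cst 0.

Lemma feasible_pos mu Q x : lp_feasible S mu Q x ->
  [/\ flow_ae_eq S x (pos x), lp_feasible S mu Q (pos x) & forall i s, 0 <= pos x i s].
Proof.
move=> fx; have [mx x0 _ _] := fx.
have xp : flow_ae_eq S x (pos x).
  by move=> i; apply: filterS (x0 i) => s xs Ss; rewrite /pos/= max_l// xs.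
split=> //; last by move=> i s; rewrite /pos/= le_max lexx orbT.
apply: lp_feasible_ae fx => // i.
by apply: measurable_maxr => //; exact: measurable_cst.
Qed.

End AlmostEverywhere.

(** * Optimality and uniqueness of the sorted flow *)

Section Bottleneck.
Context {R : realType} {K : nat}.
Variables (beta : 'I_K -> R) (fe : R -> R) (mu : R) (Q : 'I_K -> R) (S : set R).
Hypotheses (beta_gt0 : forall i, 0 < beta i)
  (beta_decr : forall i j : 'I_K, (i < j)%N -> beta j < beta i)
  (fe_cont : {within `]-oo, 0], continuous fe})
  (fe_decr : forall s t : R, s < t -> t <= 0 -> fe t < fe s)
  (fe0 : fe 0 = 0)
  (mu_gt0 : 0 < mu) (Q_gt0 : forall i, 0 < Q i)
  (mS : measurable S) (TS : `[- breakpoint mu Q K, 0] `<=` S).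
Local Notation s_ := (breakpoint mu Q).
Local Notation c := (late_prohibited_cost beta fe).
Local Notation leb := (@lebesgue_measure R).
Local Notation sorted := (sorted_flow mu Q).
Implicit Types x y : 'I_K -> R -> R.

(** The cost common to all groups once [beta i] is factored out; positivity of [beta i] preserves
    [+oo]. *)
Definition unit_cost (s : R) : \bar R := if s <= 0 then (fe s)%:E else +oo%E.

Lemma cost_unit i s : c i s = ((beta i)%:E * unit_cost s)%E.
Proof.
rewrite /late_prohibited_cost /unit_cost; case: ifP => // _.
by rewrite gt0_muley// lte_fin.
Qed.

Lemma fe_anti s t : s <= t -> t <= 0 -> fe t <= fe s.
Proof. by rewrite le_eqVlt => /orP[/eqP->//|st t0]; rewrite ltW// fe_decr. Qed.

Lemma unit_cost_ge0 s : (0 <= unit_cost s)%E.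
Proof.
rewrite /unit_cost; case: ifP => [s0|_]; last exact: leey.
by rewrite lee_fin -fe0 fe_anti.
Qed.

Lemma measurable_unit_cost : measurable_fun S unit_cost.
Proof.
apply: (@measurable_funS _ _ _ _ setT) => //.
apply: measurable_fun_if => //; first exact: measurable_fun_ler.
apply/measurable_EFinP.
rewrite (_ : _ `&` _ = `]-oo, 0]%classic).
  by apply: subspace_continuous_measurable_fun.
by apply/seteqP; split=> s /=; rewrite in_itv/=; [case|split].
Qed.

Lemma measurable_cost i : measurable_fun S (c i).
Proof.
rewrite (_ : c i = fun s => ((beta i)%:E * unit_cost s)%E); last first.
  by apply/funext => s; exact: cost_unit.
by apply: measurable_funeM; exact: measurable_unit_cost.
Qed.

(* The default value 0 plays the role of beta_(K+1). *)
Let beta0 (n : nat) : R := oapp beta 0 (insub n).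
Let gap (j : 'I_K) : R := beta0 j - beta0 j.+1.

Let beta0E (i : 'I_K) : beta0 i = beta i.
Proof. by rewrite /beta0 valK. Qed.

Let gap_gt0 j : 0 < gap j.
Proof.
rewrite /gap beta0E subr_gt0 /beta0; case: insubP => //= k _ kj.
by apply: beta_decr; rewrite kj.
Qed.

(** The gaps telescope up to [beta0 K], which is the default [0]. *)
Let sum_gap (i : 'I_K) : \sum_(j < K | (i <= j)%N) gap j = beta i.
Proof.
rewrite -(big_geq_mkord i K xpredT (fun j => beta0 j - beta0 j.+1)).
rewrite (@telescope_sumr_eq _ i K (fun j => - beta0 j)) ?(ltnW (ltn_ord i))//; last first.
  by move=> j _; rewrite opprK addrC.
by rewrite beta0E /beta0 insubF ?ltnn//= oppr0 add0r opprK.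
Qed.

(** The aggregate [Y_j]. With zero-based [j] it collects [j.+1] groups, hence the index [j.+1] of
    its window below. *)
Definition group_flow (x : 'I_K -> R -> R) (j : 'I_K) (s : R) : R :=
  \sum_(i < K | (i <= j)%N) x i s.

(* Abel summation: the objective is a positive combination of one-group costs. *)
Lemma objective_abel x :
  (forall i, measurable_fun S (x i)) -> (forall i s, 0 <= x i s) ->
  lp_objective S c x = (\sum_(j < K)
    (gap j)%:E * \int[leb]_(s in S) (unit_cost s * (group_flow x j s)%:E))%E.
Proof.
move=> mx x0; pose u i := (\int[leb]_(s in S) (unit_cost s * (x i s)%:E))%E.
have mux i : measurable_fun S (fun s => unit_cost s * (x i s)%:E)%E.
  apply: emeasurable_funM; first exact: measurable_unit_cost.
  by apply/measurable_EFinP; exact: mx.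
have ux0 i s : (0 <= unit_cost s * (x i s)%:E)%E.
  by rewrite mule_ge0 ?unit_cost_ge0// lee_fin.
have u0 i : (0 <= u i)%E by exact: integral_ge0.
transitivity (\sum_(i < K) \sum_(j < K | (i <= j)%N) (gap j)%:E * u i)%E.
  apply: eq_bigr => i _.
  under eq_integral do rewrite cost_unit -muleA.
  rewrite ge0_integralZl//; [|exact: mux|by rewrite lee_fin ltW].
  by rewrite -ge0_sume_distrl ?sumEFin ?sum_gap// => j _; rewrite lee_fin ltW.
(* Exchanging the sums collects, for each gap [j], the groups whose weight contains it. *)
transitivity (\sum_(j < K) \sum_(i < K | (i <= j)%N) (gap j)%:E * u i)%E.
  by apply: exchange_big_dep.
apply: eq_bigr => j _.
rewrite -ge0_sume_distrr//; congr (_ * _)%E.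
(* The condition on [i] moves into the summation list so that the sum can enter the integral. *)
rewrite -big_filter -ge0_integral_sum//; apply: eq_integral => s _.
rewrite big_filter -ge0_sume_distrr ?sumEFin// => i _.
by rewrite lee_fin.
Qed.

(** The window that holds exactly the first [j] groups when filled at rate [mu]. *)
Let level (j : nat) := `]- s_ j, 0]%classic.

Let level_sub j : (j <= K)%N -> level j `<=` S.
Proof.
move=> jK s; rewrite /level/= in_itv/= => /andP[js s0]; apply: TS.
rewrite /= in_itv/= s0 andbT (le_trans _ (ltW js))// lerN2.
exact: le_breakpoint.
Qed.

(** Both sides equal the total demand of the first [j.+1] groups: this is the equal-mass hypothesis
    of the bathtub principle. *)
Lemma integral_group_flow x (j : 'I_K) : lp_feasible S mu Q x ->
  (forall i s, 0 <= x i s) ->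
  (\int[leb]_(s in S) (group_flow x j s)%:E = mu%:E * leb (level j.+1))%E.
Proof.
move=> [mx _ _ xQ] x0; under eq_integral do rewrite -sumEFin -big_filter.
rewrite ge0_integral_sum//; last 2 first.
- by move=> i; apply/measurable_EFinP; exact: mx.
- by move=> i s _; rewrite lee_fin.
rewrite big_filter (eq_bigr _ (fun i _ => xQ i)) sumEFin.
rewrite lebesgue_measure_itv/= lte_fin oppr_lt0.
rewrite (le_lt_trans _ (lt_breakpoint mu_gt0 Q_gt0 j)) ?breakpoint_ge0//.
by rewrite -EFinB -EFinM; congr EFin; rewrite /breakpoint opprK add0r mulrC divfK ?gt_eqF.
Qed.

(** * The bathtub principle for one aggregate flow *)

Section GroupBathtub.
Variables (x : 'I_K -> R -> R) (j : 'I_K).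
Hypotheses (fx : lp_feasible S mu Q x) (x0 : forall i s, 0 <= x i s).

(** The cost at the left end of the window. As [fe] decreases and lateness costs [+oo], the window
    is a sublevel set for this value. *)
Let threshold := fe (- s_ j.+1).

Let sj0 : - s_ j.+1 <= 0.
Proof. by rewrite oppr_le0 breakpoint_ge0. Qed.

Let threshold_ge0 : 0 <= threshold.
Proof. by rewrite -fe0 fe_anti. Qed.

Let cost_below s : level j.+1 s -> (unit_cost s <= threshold%:E)%E.
Proof.
rewrite /level/= in_itv/= => /andP[js s0].
by rewrite /unit_cost s0 lee_fin fe_anti// ltW.
Qed.

Let cost_above s : S s -> ~ level j.+1 s -> (threshold%:E <= unit_cost s)%E.
Proof.
move=> _; rewrite /level/= in_itv/= /unit_cost; case: (leP s 0); rewrite ?andbT.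
  by move=> s0 /negP; rewrite -leNgt => sj; rewrite lee_fin fe_anti.
by rewrite leey.
Qed.

Let measurable_group : measurable_fun S (group_flow x j).
Proof.
have [mx _ _ _] := fx; rewrite /group_flow.
by under eq_fun do rewrite -big_filter; exact: measurable_sum.
Qed.

Let group_ge0 s : S s -> 0 <= group_flow x j s.
Proof. by move=> _; exact: sumr_ge0. Qed.

Let group_le : {ae leb, forall s, S s -> group_flow x j s <= mu}.
Proof.
have [_ _ xmu _] := fx; apply: filterS xmu => s xs Ss.
apply: le_trans (xs Ss); rewrite /group_flow big_mkcond/=.
by apply: ler_sum => i _; case: ifP.
Qed.

Let level_fin : (leb (level j.+1) < +oo)%E.
Proof. by rewrite lebesgue_measure_itv/=; case: ifP => _; rewrite ?ltry. Qed.

Lemma group_cost_ge :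
  (\int[leb]_(s in S) (unit_cost s * (mu * \1_(level j.+1) s)%:E) <=
   \int[leb]_(s in S) (unit_cost s * (group_flow x j s)%:E))%E.
Proof.
apply: (@bathtub_le _ _ _ leb S (level j.+1) unit_cost threshold) => //.
- exact: measurable_itv.
- exact: level_sub.
- exact: measurable_unit_cost.
- by move=> s _; exact: unit_cost_ge0.
- exact: ltW.
- exact: integral_group_flow.
Qed.

(** The window has finite length and cost at most [threshold]. Finiteness is what [sume_le_eq] asks
    of the minimal costs. *)
Lemma group_cost_fin :
  (\int[leb]_(s in S) (unit_cost s * (mu * \1_(level j.+1) s)%:E))%E \is a fin_num.
Proof.
rewrite ge0_fin_numE; last first.
  apply: integral_ge0 => s _; rewrite mule_ge0 ?unit_cost_ge0// lee_fin.
  by rewrite mulr_ge0 ?(ltW mu_gt0)// indicE.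
apply: (@bathtub_fin _ _ _ leb S (level j.+1) unit_cost threshold) => //.
- exact: measurable_itv.
- exact: level_sub.
- exact: measurable_unit_cost.
- by move=> s _; exact: unit_cost_ge0.
- exact: ltW.
Qed.

Lemma group_cost_eq :
  (\int[leb]_(s in S) (unit_cost s * (group_flow x j s)%:E) =
   \int[leb]_(s in S) (unit_cost s * (mu * \1_(level j.+1) s)%:E))%E ->
  {ae leb, forall s, S s -> group_flow x j s = mu * \1_(level j.+1) s}.
Proof.
move=> costE.
have H : {ae leb, forall s, S s -> unit_cost s != threshold%:E ->
    group_flow x j s = mu * \1_(level j.+1) s}.
  apply: (@bathtub_eq _ _ _ leb S (level j.+1) unit_cost threshold) => //.
  - exact: measurable_itv.
  - exact: level_sub.
  - exact: measurable_unit_cost.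
  - by move=> s _; exact: unit_cost_ge0.
  - exact: ltW.
  - exact: integral_group_flow.
(* By strict monotonicity of [fe], the cost meets the threshold only at [- s_ j.+1], a null set, so
   ties are negligible. *)
apply: filterS2 H (ae_neq (- s_ j.+1)) => s H sj Ss; apply: H => //.
rewrite /unit_cost; case: ifP => // s0; rewrite eqe /threshold.
case: (ltgtP s (- s_ j.+1)) sj => // sj _.
  by rewrite gt_eqF// fe_decr.
by rewrite lt_eqF// fe_decr.
Qed.

End GroupBathtub.

(** Every aggregate of the sorted flow is its bathtub minimizer, so all the minima are attained at
    once. *)
Lemma group_sorted_flow (j : 'I_K) s :
  group_flow sorted j s = mu * \1_(level j.+1) s.
Proof. exact: (sum_sorted_flow mu_gt0 Q_gt0 s (ltn_ord j)). Qed.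

Let sorted_sub (i : 'I_K) : `]- s_ i.+1, - s_ i] `<=` S.
Proof.
move=> s; rewrite /= in_itv/= => /andP[h1 h2]; apply: (level_sub (ltn_ord i)).
by rewrite /level/= in_itv/= h1/= (le_trans h2)// oppr_le0 breakpoint_ge0.
Qed.

Lemma sorted_flow_feasible : lp_feasible S mu Q sorted.
Proof.
split.
- by move=> i; exact: measurable_sorted_flow.
- by move=> i; apply: aeW => s _; exact: sorted_flow_ge0.
- apply: aeW => s _; rewrite (eq_bigl (fun i : 'I_K => (i < K)%N)); last first.
    by move=> i; rewrite ltn_ord.
  by rewrite sum_sorted_flow// ler_piMr ?(ltW mu_gt0)// indicE lern1 leq_b1.
- by move=> i; apply: integral_sorted_flow.
Qed.

Lemma objective_sorted_le x : lp_feasible S mu Q x -> (forall i s, 0 <= x i s) ->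
  (lp_objective S c sorted <= lp_objective S c x)%E.
Proof.
move=> fx x0; have [mx _ _ _] := fx.
rewrite !objective_abel//; last 2 first.
- by move=> i; exact: measurable_sorted_flow.
- by move=> i s; exact: sorted_flow_ge0.
apply: lee_sum => j _; rewrite lee_pmul2l ?lte_fin//.
under eq_integral do rewrite group_sorted_flow.
exact: group_cost_ge.
Qed.

(** Since all gaps are positive, a total no larger than that of the sorted flow forces each
    aggregate cost to be minimal, which fixes each aggregate almost everywhere. *)
Lemma objective_le_sorted x : lp_feasible S mu Q x -> (forall i s, 0 <= x i s) ->
  (lp_objective S c x <= lp_objective S c sorted)%E -> flow_ae_eq S x sorted.
Proof.
move=> fx x0; have [mx _ _ _] := fx.
rewrite !objective_abel//; last 2 first.
- by move=> i; exact: measurable_sorted_flow.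
- by move=> i s; exact: sorted_flow_ge0.
have sortedE j : (\int[leb]_(s in S) (unit_cost s * (group_flow sorted j s)%:E) =
    \int[leb]_(s in S) (unit_cost s * (mu * \1_(level j.+1) s)%:E))%E.
  by apply: eq_integral => s _; rewrite group_sorted_flow.
rewrite [leRHS](eq_bigr _ (fun j _ => congr1 _ (sortedE j))).
move=> /(sume_le_eq gap_gt0 group_cost_fin (fun j => group_cost_ge j fx x0)) costE i.
(* One null set serves the finitely many [j], so all partial sums can be compared at the same
   [s]. *)
have : {ae leb, forall s, forall j, S s -> group_flow x j s = mu * \1_(level j.+1) s}.
  apply: filter_forall => j; apply: group_cost_eq => //; exact: costE.
apply: filterS => s xs Ss.
apply: (partial_sums_inj (f := x^~ s) (g := sorted^~ s)) => j.
by rewrite -/(group_flow x j s) xs// -group_sorted_flow.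
Qed.

Lemma sorted_flow_optimal : lp_optimal S c mu Q sorted.
Proof.
split=> [|y fy]; first exact: sorted_flow_feasible.
have [yp fp p0] := feasible_pos mS fy.
have [my _ _ _] := fy; have [mp _ _ _] := fp.
rewrite (lp_objective_ae mS measurable_cost my mp yp).
exact: objective_sorted_le.
Qed.

Lemma optimal_sorted_flow x : lp_optimal S c mu Q x -> flow_ae_eq S x sorted.
Proof.
move=> [fx xopt]; have [xp fp p0] := feasible_pos mS fx.
have [mx _ _ _] := fx; have [mp _ _ _] := fp.
apply: (flow_ae_eq_trans xp); apply: objective_le_sorted => //.
rewrite -(lp_objective_ae mS measurable_cost mx mp xp).
by apply: xopt; exact: sorted_flow_feasible.
Qed.

End Bottleneck.

Theorem proposition6p1 (R : realType) (K : nat) (K_gt0 : (0 < K)%N)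
  (beta : 'I_K -> R)
  (beta_gt0 : forall i, 0 < beta i)
  (beta_decr : forall i j : 'I_K, (i < j)%N -> beta j < beta i)
  (fe : R -> R)
  (fe_cont : {within `]-oo, 0], continuous fe})
  (fe_decr : forall s t : R, s < t -> t <= 0 -> fe t < fe s)
  (fe0 : fe 0 = 0)
  (mu : R) (mu_gt0 : 0 < mu)
  (Q : 'I_K -> R) (Q_gt0 : forall i, 0 < Q i)
  (S : set R) (S_itv : is_interval S)
  (S_long : `[- ((\sum_(i < K) Q i) / mu), (\sum_(i < K) Q i) / mu]
              `<=` interior S) :
  let c := late_prohibited_cost beta fe in
  let T := (\sum_(i < K) Q i) / mu in
  let s_ := breakpoint mu Q in
  (exists x, lp_optimal S c mu Q x) /\
  (forall x y, lp_optimal S c mu Q x -> lp_optimal S c mu Q y ->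
     flow_ae_eq S x y) /\
  (forall x, lp_optimal S c mu Q x ->
     (forall kappa z : R, 1 <= kappa <= K%:R -> 0 <= z <= T ->
        cumulative_flow x kappa z =
        (Num.min (\sum_(i < K | i.+1%:R <= kappa) Q i) (mu * z))%:E) /\
     (forall i : 'I_K,
        {ae lebesgue_measure, forall s,
           (S `\` `[- s_ i.+1, - s_ i]) s -> x i s = 0})) /\
  (forall i : 'I_K, - s_ i - - s_ i.+1 = Q i / mu) /\
  [/\ - T = - s_ K,
      forall i : 'I_K, - s_ i.+1 < - s_ i &
      - s_ 0%N = 0].
Proof.
move=> c T s_.
have mS : measurable S := is_interval_measurable S_itv.
have sK : s_ K = T := breakpoint_last mu Q.
have TS z : z <= T -> `[- z, 0] `<=` S.
  move=> zT s /=; rewrite in_itv/= => /andP[zs s0].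
  apply: interior_subset; apply: S_long.
  rewrite /= in_itv/= -/T (le_trans _ zs) ?lerN2//=.
  by rewrite (le_trans s0)// -sK breakpoint_ge0.
have TSK : `[- s_ K, 0] `<=` S by apply: TS; rewrite sK.
(* Uniqueness, the cumulative formula and sorting all reduce to this comparison with the explicit
   flow. *)
have opt x : lp_optimal S c mu Q x -> flow_ae_eq S x (sorted_flow mu Q).
  exact: optimal_sorted_flow.
split; first by exists (sorted_flow mu Q); exact: sorted_flow_optimal.
split.
  move=> x y /opt xs /opt/flow_ae_eq_sym ys; exact: flow_ae_eq_trans xs ys.
split.
  move=> x xopt; split=> [kappa z /andP[_ kK] /andP[z0 zT]|i].
    rewrite -cumulative_flow_sorted//; apply: (cumulative_flow_ae mS).
    - exact: TS.
    - by case: xopt => -[].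
    - by move=> i; exact: measurable_sorted_flow.
    - exact: opt.
  (* The half-open support of the sorted flow lies in the closed interval of the claim. *)
  apply: filterS (opt _ xopt i) => s xs [Ss sI]; rewrite xs// /sorted_flow indicE.
  rewrite memNset ?mulr0// => /= sI'; apply: sI; move: sI'.
  by rewrite /= !in_itv/= => /andP[/ltW -> ->].
split; first by move=> i; rewrite /s_ breakpointS; ring.
split; first by rewrite sK.
- by move=> i; rewrite ltrN2 lt_breakpoint.
- by rewrite /s_ breakpoint0 oppr0.
Qed.
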